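(* Consider finding the $n$th prime $p_n$ by the interval sieve over an interval $[i,j]$ containing $p_n$. In order for the interval sieve to beat the binary search algorithm asymptotically when attempting to find $p_n$, the size of $[i,j]$ must be less than $$\sqrt{n}\cdot\frac{(\log n)^4}{\log\log n}$$ up to some constant.
   Context: Here $p_n$ is the $n$th prime, $\log$ is the natural logarithm, $\pi(x)$ is the number of primes $\le x$, and the size of $[i,j]$ is $j-i+1$. The binary search algorithm finds $p_n$, given $n$, by binary search with evaluations of $\pi(x)$; its running time is $O(\sqrt{n}\,(\log n)^4)$. The interval sieve finds $p_n$ by sieving the interval $[i,j]$ with a segmented sieve, using a counter initialized at $\pi(i)$ and incremented for each prime in $[i,j]$. The list of primes up to $\sqrt{j}$ is assumed to be precomputed, and the time complexity of the interval sieve is then taken to be $O((j-i+1)\log\log j)$. To beat binary search asymptotically refers to the comparison of these two running-time bounds, up to constant factors, as $n$ grows. *)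

(* Defs.v *)
From mathcomp Require Import all_boot all_order all_algebra.
From mathcomp Require Import all_classical all_reals all_analysis.
Set Implicit Arguments.
Unset Strict Implicit.
Unset Printing Implicit Defensive.
Import Order.TTheory GRing.Theory Num.Theory numFieldNormedType.Exports.
Local Open Scope classical_set_scope.
Local Open Scope ring_scope.

Lemma exists_prime_above (m : nat) : exists p, ((m < p) && prime p)%N.
Proof. by have [p mp pp] := prime_above m; exists p; rewrite mp. Qed.

Definition next_prime (m : nat) : nat := ex_minn (exists_prime_above m).

(* 1-indexed: nth_prime 1 = 2, and the value nth_prime 0 = 0 is junk. *)
Definition nth_prime (n : nat) : nat := iter n next_prime 0%N.

Definition prime_pi (x : nat) : nat := count prime (iota 0 x.+1).

Lemma prime_nth_prime (n : nat) : (0 < n)%N -> prime (nth_prime n).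
Proof.
case: n => // n _; rewrite /nth_prime iterS /next_prime.
by case: ex_minnP => p /andP[].
Qed.

Lemma prime_pi_nth_prime (n : nat) : prime_pi (nth_prime n) = n.
Proof.
elim: n => [//|n IHn]; rewrite /nth_prime iterS -/(nth_prime n) /next_prime.
case: ex_minnP => p /andP[np pp] pmin.
rewrite /prime_pi; have -> : p.+1 = ((nth_prime n).+1 + (p - (nth_prime n).+1 + 1))%N.
  by rewrite addnA subnKC // addn1.
rewrite 2!iotaD !count_cat -/(prime_pi (nth_prime n)) IHn !add0n.
rewrite subnKC //= pp !addn0.
suff -> : count prime (iota (nth_prime n).+1 (p - (nth_prime n).+1)) = 0%N by rewrite add0n addn1.
apply/eqP; rewrite eqn0Ngt -has_count; apply/hasPn => q.
rewrite mem_iota subnKC // => /andP[nq qp]; apply/negP => pq.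
by have := pmin q; rewrite nq pq leqNgt qp => /(_ isT).
Qed.

Definition interval_size (i j : nat) : nat := (j - i + 1)%N.

Definition interval_sieve_time (R : realType) (i j : nat) : R :=
  (interval_size i j)%:R * ln (ln j%:R).

Definition binary_search_time (R : realType) (n : nat) : R :=
  Num.sqrt n%:R * ln n%:R ^+ 4.

(* For each n, the sieve is run on [i n, j n]. Comparing up to constant factors
   means big-O, so ties count as beating; little-o is a special case. *)
Definition sieve_beats_binary_search (R : realType) (i j : nat -> nat) : Prop :=
  (fun n => interval_sieve_time R (i n) (j n)) =O_\oo (@binary_search_time R).

(* Main.v *)
Require Import Defs.
From mathcomp Require Import all_boot all_order all_algebra.
From mathcomp Require Import all_classical all_reals all_analysis.
Import Order.TTheory GRing.Theory Num.Theory numFieldNormedType.Exports.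
Local Open Scope classical_set_scope.
Local Open Scope ring_scope.

(** The sieving cost per integer of [i, j] is ln (ln j). Since the interval
    contains the nth prime, j >= p_n >= n, so this cost is at least
    ln (ln n), which is positive once n > e. Hence
    size * ln (ln n) <= sieve time <= C * sqrt n * (ln n)^4 for large n, and
    dividing by ln (ln n) gives the bound with the same constant C. The bound
    p_n >= n (lemma [leq_nth_prime]) holds because primes are distinct positive
    integers; it loses only a factor tending to 1, as ln (ln p_n) ~ ln (ln n). *)

Lemma ltn_next_prime (m : nat) : (m < next_prime m)%N.
Proof. by rewrite /next_prime; case: ex_minnP => p /andP[]. Qed.

Lemma leq_nth_prime (n : nat) : (n <= nth_prime n)%N.
Proof.
elim: n => // n IHn; rewrite /nth_prime iterS.
exact: leq_ltn_trans IHn (ltn_next_prime _).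
Qed.

Lemma ln_ln_gt0 {R : realType} {x : R} : expR 1 < x -> 0 < ln (ln x).
Proof.
move=> ex; apply: ln_gt0.
by rewrite -[ltLHS]expRK ltr_ln // posrE ?expR_gt0 // (lt_trans _ ex) ?expR_gt0.
Qed.

(** For x < 1 monotonicity fails: there the inner logarithm is not positive, and
    the outer one takes the conventional value 0. *)
Lemma ler_ln_ln {R : realType} {x y : R} :
  1 < x -> x <= y -> ln (ln x) <= ln (ln y).
Proof.
move=> x1 xy.
have x0 : 0 < x := lt_trans ltr01 x1.
have lx0 : 0 < ln x by exact: ln_gt0.
have lxy : ln x <= ln y by rewrite ler_ln // posrE (lt_le_trans x0).
by rewrite ler_ln // posrE (lt_le_trans lx0).
Qed.

Theorem theorem5p1 (R : realType) (i j : nat -> nat)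
    (hij : forall n : nat, (0 < n)%N -> (i n <= nth_prime n <= j n)%N)
    (hbeats : sieve_beats_binary_search R i j) :
  (fun n : nat => (interval_size (i n) (j n))%:R : R) =O_\oo
    (fun n : nat => Num.sqrt n%:R * (ln n%:R ^+ 4 / ln (ln n%:R)) : R).
Proof.
apply/eqOP; move/eqOP: hbeats; apply: filterS => C hC.
near=> n.
have en : expR 1 < n%:R :> R by near: n; exact: nbhs_infty_gtr.
have n0 : (0 < n)%N by rewrite -(ltr_nat R) (lt_trans _ en) ?expR_gt0.
have n1 : 1 < n%:R :> R by apply: lt_trans en; rewrite expR_gt1.
have llpos := ln_ln_gt0 en.
have nj : (n%:R : R) <= (j n)%:R.
  rewrite ler_nat (leq_trans (leq_nth_prime n)) //.
  by case/andP: (hij n n0).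
have llnj := ler_ln_ln n1 nj.
have : `|interval_sieve_time R (i n) (j n)| <= C * `|binary_search_time R n|.
  by near: n.
rewrite /interval_sieve_time /binary_search_time => hn.
rewrite mulrA [in leRHS]normrM normfV (gtr0_norm llpos) mulrA ler_pdivlMr //.
apply: le_trans hn; rewrite normrM ler_wpM2l //.
exact: le_trans llnj (ler_norm _).
Unshelve. all: by end_near.
Qed.
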